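(* Let $\theta>0$ and $\varepsilon\in(0,1)$. Let $\mathbf{A}\in\mathbb{R}^{L\times K}$, $\mathbf{a}\in\mathbb{R}^L$, $\mathbf{b}\in\mathbb{R}^K$ and $b\in\mathbb{R}$, and assume that $\mathbf{A}^\top\mathbf{x}\ne\mathbf{b}$ for all $\mathbf{x}\in\mathcal{X}$. For the safety set $\mathcal{S}(\mathbf{x})=\{\boldsymbol{\xi}\in\mathbb{R}^K\mid(\mathbf{A}\boldsymbol{\xi}+\mathbf{a})^\top\mathbf{x}<\mathbf{b}^\top\boldsymbol{\xi}+b\}$, the distributionally robust chance constrained program $$\min_{\mathbf{x}\in\mathcal{X}}\ \mathbf{c}^\top\mathbf{x}\quad\text{s.t.}\quad\mathbb{P}[\tilde{\boldsymbol{\xi}}\in\mathcal{S}(\mathbf{x})]\ge1-\varepsilon\quad\forall\,\mathbb{P}\in\mathcal{F}(\theta)$$ is equivalent to the mixed integer conic program $$\begin{array}{cll}\displaystyle\min_{\mathbf{q},\mathbf{s},t,\mathbf{x}}&\mathbf{c}^\top\mathbf{x}\\ \text{s.t.}&\varepsilon Nt-\mathbf{e}^\top\mathbf{s}\ge\theta N\,\|\mathbf{b}-\mathbf{A}^\top\mathbf{x}\|_*\\ &(\mathbf{b}-\mathbf{A}^\top\mathbf{x})^\top\hat{\boldsymbol{\xi}}_i+b-\mathbf{a}^\top\mathbf{x}+\mathrm{M}q_i\ge t-s_i&\forall i\in\{1,\dots,N\}\\ &\mathrm{M}(1-q_i)\ge t-s_i&\forall i\in\{1,\dots,N\}\\ &\mathbf{q}\in\{0,1\}^N,\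 \mathbf{s}\ge\mathbf{0},\ \mathbf{x}\in\mathcal{X},\end{array}$$ with variables $\mathbf{q},\mathbf{s}\in\mathbb{R}^N$, $t\in\mathbb{R}$, $\mathbf{x}\in\mathbb{R}^L$, where $\mathrm{M}$ is a suitably large (but finite) positive constant.
   Context: Setting. $\|\cdot\|$ is an arbitrary norm on $\mathbb{R}^K$ with dual norm $\|\cdot\|_*$, and $\mathcal{P}(\mathbb{R}^K)$ is the set of all probability distributions on $\mathbb{R}^K$. For $\mathbb{P}_1,\mathbb{P}_2\in\mathcal{P}(\mathbb{R}^K)$ the (type-1) Wasserstein distance is $d_{\rm W}(\mathbb{P}_1,\mathbb{P}_2)=\inf_{\mathbb{P}\in\mathcal{P}(\mathbb{P}_1,\mathbb{P}_2)}\mathbb{E}_{\mathbb{P}}[\|\tilde{\boldsymbol{\xi}}_1-\tilde{\boldsymbol{\xi}}_2\|]$, where $\mathcal{P}(\mathbb{P}_1,\mathbb{P}_2)$ is the set of all distributions of $(\tilde{\boldsymbol{\xi}}_1,\tilde{\boldsymbol{\xi}}_2)$ on $\mathbb{R}^K\times\mathbb{R}^K$ with marginals $\mathbb{P}_1$ and $\mathbb{P}_2$. Given training samples $\hat{\boldsymbol{\xi}}_1,\dots,\hat{\boldsymbol{\xi}}_N\in\mathbb{R}^K$ ($N\ge1$), let $\hat{\mathbb{P}}=\frac1N\sum_{i=1}^N\delta_{\hat{\boldsymbol{\xi}}_i}$ be the empirical distribution, and define the Wasserstein ambiguity set $\mathcal{F}(\theta)=\{\mathbb{P}\in\mathcal{P}(\mathbb{R}^K)\mid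 d_{\rm W}(\mathbb{P},\hat{\mathbb{P}})\le\theta\}$. $\mathcal{X}\subseteq\mathbb{R}^L$ is a compact polyhedron and $\mathbf{c}\in\mathbb{R}^L$. $\mathbf{e}$ is the all-ones vector, $\mathbf{0}$ the zero vector, and vector inequalities are componentwise. Note that $\mathbf{b}$ (vector) and $b$ (scalar) are different objects. ''Equivalent, where $\mathrm{M}$ is a suitably large (but finite) positive constant'' means: there is a finite constant $\mathrm{M}_0>0$ such that for every $\mathrm{M}\ge\mathrm{M}_0$, a decision $\mathbf{x}$ is feasible in the chance constrained program if and only if there exist $(\mathbf{q},\mathbf{s},t)$ such that $(\mathbf{q},\mathbf{s},t,\mathbf{x})$ is feasible in the mixed integer conic program (so that, the objectives being identical, optimal values and optimal decisions $\mathbf{x}$ coincide). *)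

(* Defs.v *)
From HB Require Import structures.
From mathcomp Require Import all_boot all_order all_algebra.
From mathcomp Require Import all_classical all_reals all_analysis.
Import Order.TTheory GRing.Theory Num.Theory numFieldNormedType.Exports.

Set Implicit Arguments.
Unset Strict Implicit.
Unset Printing Implicit Defensive.

Local Open Scope classical_set_scope.
Local Open Scope ring_scope.

(* R^K is the type of column vectors 'cV[R]_K with its Borel sigma-algebra,
   i.e. the one generated by the open sets of the library topology on
   matrices, which is the usual (product) topology of R^K. The product
   measurableType of two copies carries the product sigma-algebra, which is
   the Borel sigma-algebra of R^K x R^K by second countability. *)
Notation borel_cV R K := (g_sigma_algebraType (open : set (set 'cV[R]_K))).

Section vectors.
Context {R : realType}.

Definition dot n (u v : 'cV[R]_n) : R := (u^T *m v) 0 0.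

(* An arbitrary norm on R^n, independent of the library's canonical norm
   `|_| on matrices (the maximum norm). *)
Record is_norm n (nrm : 'cV[R]_n -> R) : Prop := IsNorm {
  norm_triangle : forall u v, nrm (u + v) <= nrm u + nrm v ;
  norm_homogeneous : forall (r : R) u, nrm (r *: u) = `|r| * nrm u ;
  norm_definite : forall u, nrm u = 0 -> u = 0 }.

Definition dual_norm n (nrm : 'cV[R]_n -> R) (v : 'cV[R]_n) : R :=
  sup [set dot v u | u in [set u | nrm u <= 1]].

Definition polyhedron n (X : set 'cV[R]_n) : Prop :=
  exists (m : nat) (G : 'M[R]_(m, n)) (h : 'cV[R]_m),
    X = [set x | forall i, (G *m x) i 0 <= h i 0].

End vectors.

Section wasserstein.
Context {R : realType} {K : nat}.
Local Notation T := (borel_cV R K).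
Implicit Types P : probability T R.

Definition couplings P1 P2 : set (probability (T * T)%type R) :=
  [set Q | forall A : set T, measurable A ->
     pushforward Q fst A = P1 A /\ pushforward Q snd A = P2 A].

Definition wasserstein (nrm : 'cV[R]_K -> R) P1 P2 : \bar R :=
  ereal_inf [set (\int[Q]_z (nrm ((z.1 : 'cV[R]_K) - z.2))%:E)%E
            | Q in couplings P1 P2].

Section empirical.
Context {N : nat} (N_gt0 : (0 < N)%N) (xi : 'I_N -> 'cV[R]_K).

(* The positivity proof is an argument only so that the probability
   structure below can be attached to this function. *)
Definition empirical of (0 < N)%N : set T -> \bar R :=
  fun A => ((N%:R^-1)%:E * \sum_(i < N) \d_(xi i : T) A)%E.

Local Notation Phat := (empirical N_gt0).

Let empirical0 : Phat set0 = 0%E.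
Proof. by rewrite /empirical big1 ?mule0. Qed.

Let empirical_ge0 A : (0 <= Phat A)%E.
Proof.
by apply: mule_ge0; [rewrite lee_fin invr_ge0 | apply: sume_ge0].
Qed.

Let empirical_sigma_additive : semi_sigma_additive Phat.
Proof.
move=> F mF tF mUF; rewrite /empirical.
under eq_fun.
  move=> n; rewrite -ge0_sume_distrr; last by move=> i _; exact: sume_ge0.
  rewrite exchange_big/=; over.
apply: cvgeZl => //; apply: cvg_nnesum => i _.
  by apply: nearW => n; exact: sume_ge0.
exact: (@measure_semi_sigma_additive _ _ _ (\d_(xi i : T)) F mF tF mUF).
Qed.

HB.instance Definition _ := isMeasure.Build _ _ _ Phat
  empirical0 empirical_ge0 empirical_sigma_additive.

Let empirical_setT : Phat setT = 1%E.
Proof.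
rewrite /empirical (eq_bigr (fun=> 1%:E)) => [|i _]; last by rewrite diracT.
rewrite sumEFin -EFinM big_const_ord iter_addr_0 mulVf//.
by rewrite pnatr_eq0 -lt0n.
Qed.

HB.instance Definition _ :=
  Measure_isProbability.Build _ _ _ Phat empirical_setT.

End empirical.

Definition ambiguity_set (nrm : 'cV[R]_K -> R) (N : nat) (N_gt0 : (0 < N)%N)
    (xi : 'I_N -> 'cV[R]_K) (theta : R) : set (probability T R) :=
  [set P | (wasserstein nrm P (empirical xi N_gt0) <= theta%:E)%E].

End wasserstein.

Section programs.
Context {R : realType}.

Definition optimal_value (D : Type) (F : set D) (f : D -> R) : \bar R :=
  ereal_inf [set (f z)%:E | z in F].

Definition minimizers (D : Type) (F : set D) (f : D -> R) : set D :=
  [set z | F z /\ forall y, F y -> f z <= f y].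

Context {K L N : nat}.
Variables (A : 'M[R]_(L, K)) (a : 'cV[R]_L) (b : 'cV[R]_K) (b0 : R).

Definition safety_set (x : 'cV[R]_L) : set 'cV[R]_K :=
  [set xi | dot (A *m xi + a) x < dot b xi + b0].

Variables (nrm : 'cV[R]_K -> R) (xi : 'I_N -> 'cV[R]_K) (theta eps : R).
Variable X : set 'cV[R]_L.

Definition cc_feasible (N_gt0 : (0 < N)%N) : set 'cV[R]_L :=
  [set x | X x /\ forall P, ambiguity_set nrm N_gt0 xi theta P ->
     ((1 - eps)%:E <= P (safety_set x))%E].

Definition micp_feasible (M : R)
    : set ('cV[R]_N * 'cV[R]_N * R * 'cV[R]_L) :=
  fun z => let: (q, s, t, x) := z in
    [/\ eps * N%:R * t - dot (const_mx 1) s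
          >= theta * N%:R * dual_norm nrm (b - A^T *m x),
        forall i, dot (b - A^T *m x) (xi i) + b0 - dot a x + M * q i 0
          >= t - s i 0,
        forall i, M * (1 - q i 0) >= t - s i 0 &
        [/\ forall i, q i 0 = 0 \/ q i 0 = 1,
            forall i, 0 <= s i 0 &
            X x]].

End programs.

(* Main.v *)
Require Import Defs.
From HB Require Import structures.
From mathcomp Require Import all_boot all_order all_algebra.
From mathcomp Require Import all_classical all_reals all_analysis.
From mathcomp Require Import measurable_realfun ring lra.
Import Order.TTheory GRing.Theory Num.Theory numFieldNormedType.Exports.
Local Open Scope classical_set_scope.
Local Open Scope ring_scope.

(** Fix [x] and write [v = b - A^T x], [lam] for the dual norm of [v], and
    [d y] for the positive part of the margin [dot v y + r], where
    [r = b0 - dot a x].  The unsafe set [U] is the half-space where the margin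
    is nonpositive, and [d y / lam] is the distance from [y] to [U].  The key
    fact, [robust_chance_iff], is that every distribution of the Wasserstein
    ball gives [U] mass at most [eps] iff some [t] satisfies

      theta N lam <= eps N t - sum_i (t - d (xi i))^+.

    This is a linear programming duality: moving mass into [U] at least cost is
    a fractional knapsack problem, and [t] is its dual variable.

    - Given [t], which is positive since [theta lam] is, duality between the norms yields
      [t 1_U(y) <= lam |y - z| + (t - d z)^+] ([unsafe_indic_le]); integrating
      this against any coupling of [P] with the empirical distribution bounds
      the mass [P U] by the transport cost ([unsafe_mass_le_wasserstein]).

    - If no [t] exists, a primal solution of the knapsack problem gives weights
      [w i] in [[0, 1/N]] of total strictly above [eps] and of cost strictly
      below [theta lam] ([knapsack_duality]).  Moving the mass [w i] from
      [xi i] into [U], along a direction that nearly attains the dual norm,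
      costs at most [theta]: the slack in the cost pays for not attaining the
      supremum ([transport_to_unsafe]).

    Since [t - s <= f^+] means that [t - s] is below one of [f] and [0], the
    binary variable [q i] selects which one, and a constant [M] that dominates
    all margins makes the other constraint void ([big_M_iff]).  Such an [M]
    exists because the margins are continuous in [x] and [X] is compact.
    Finally the two programs have the same projection to [x] and the same
    cost, which identifies optimal values and minimizers. *)

(** * Linear forms and dual norms *)

Section dot.
Context {R : realType} {n : nat}.
Implicit Types u v : 'cV[R]_n.

Lemma dotE u v : dot u v = \sum_i u i 0 * v i 0.
Proof. by rewrite /dot mxE; apply: eq_bigr => i _; rewrite mxE. Qed.

Lemma dotC u v : dot u v = dot v u.
Proof. by rewrite !dotE; apply: eq_bigr => i _; rewrite mulrC. Qed.

Lemma dotDr u v w : dot u (v + w) = dot u v + dot u w.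
Proof. by rewrite /dot mulmxDr mxE. Qed.

Lemma dotZr u r v : dot u (r *: v) = r * dot u v.
Proof. by rewrite /dot -scalemxAr mxE. Qed.

Lemma dotNr u v : dot u (- v) = - dot u v.
Proof. by rewrite -scaleN1r dotZr mulN1r. Qed.

Lemma dotBr u v w : dot u (v - w) = dot u v - dot u w.
Proof. by rewrite dotDr dotNr. Qed.

Lemma dotBl u v w : dot (u - v) w = dot u w - dot v w.
Proof. by rewrite dotC dotBr !(dotC w). Qed.

Lemma dot_gt0 v : v != 0 -> 0 < dot v v.
Proof.
move=> v0; rewrite dotE lt_neqAle sumr_ge0 ?andbT; last first.
  by move=> i _; rewrite -expr2 sqr_ge0.
rewrite eq_sym psumr_neq0; last by move=> i _; rewrite -expr2 sqr_ge0.
have [i vi] : exists i, v i 0 != 0.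
  apply/existsP; apply: contraNT v0 => /existsPn v0.
  by apply/eqP/colP => i; rewrite mxE; apply/eqP; rewrite -[_ == _]negbK.
by apply/hasP; exists i; rewrite ?mem_index_enum//= -expr2 exprn_even_gt0.
Qed.

Lemma dot_continuous u : continuous (dot u).
Proof.
have -> : dot u = fun v => \sum_i u i 0 * v i 0
  by apply/funext => v; rewrite dotE.
apply: continuous_big => [|i _ v]; first exact: add_continuous.
apply: (@cvgM _ _ _ (nbhs_filter v)); first exact: cvg_cst.
exact: coord_continuous.
Qed.

End dot.

Lemma dot_mulmx {R : realType} {m n} (A : 'M[R]_(m, n)) (u : 'cV[R]_n) v :
  dot (A *m u) v = dot (A^T *m v) u.
Proof. by rewrite [RHS]dotC /dot trmx_mul mulmxA. Qed.

Section dual_norm.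
Context {R : realType} {n : nat} {nrm : 'cV[R]_n -> R}.
Hypothesis nrm_norm : is_norm nrm.
Implicit Types u v : 'cV[R]_n.

Lemma nrm0 : nrm 0 = 0.
Proof. by rewrite -(scale0r 0) (norm_homogeneous nrm_norm) normr0 mul0r. Qed.

Lemma nrmN u : nrm (- u) = nrm u.
Proof. by rewrite -scaleN1r (norm_homogeneous nrm_norm) normrN1 mul1r. Qed.

Lemma nrm_ge0 u : 0 <= nrm u.
Proof.
have := norm_triangle nrm_norm u (- u).
by rewrite subrr nrm0 nrmN -mulr2n pmulrn_lge0.
Qed.

Lemma nrm_gt0 u : u != 0 -> 0 < nrm u.
Proof.
move=> u0; rewrite lt_neqAle nrm_ge0 andbT eq_sym.
by apply: contraNneq u0 => /(norm_definite nrm_norm) ->.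
Qed.

Lemma coord_le_norm m (w : 'rV[R]_m) i : `|w 0 i| <= `|w|.
Proof.
by rewrite [leRHS]/Num.norm /= mx_normrE; apply: (le_bigmax _ _ (0, i)).
Qed.

Lemma nrm_le_max : exists C : R, 0 <= C /\ forall w : 'rV_n, nrm w^T <= C * `|w|.
Proof.
exists (\sum_i nrm (delta_mx i 0)); split.
  by apply: sumr_ge0 => i _; exact: nrm_ge0.
move=> w.
have -> : w^T = \sum_i w 0 i *: delta_mx i 0.
  by rewrite [LHS]matrix_sum_delta; apply: eq_bigr => i _; rewrite big_ord1 mxE.
rewrite mulr_suml.
elim/big_ind2 : _ => [|x1 x2 y1 y2 h1 h2|i _]; first by rewrite nrm0.
  by apply: le_trans (lerD h1 h2); exact: norm_triangle nrm_norm _ _.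
rewrite (norm_homogeneous nrm_norm) mulrC ler_wpM2l ?nrm_ge0//.
exact: coord_le_norm.
Qed.

(** Transposed to row vectors, the space where the Heine-Borel theorem
    [bounded_closed_compact] is stated. *)
Lemma nrm_tr_continuous : continuous (fun w : 'rV[R]_n => nrm w^T).
Proof.
have [C [C0 hC]] := nrm_le_max.
move=> w; apply/(@cvgrPdist_le _ _ _ _ (nbhs_filter w)) => e e0.
have C1 : 0 < C + 1 by rewrite ltr_wpDl.
near=> y.
have le_sub (x z : 'rV[R]_n) : nrm x^T - nrm z^T <= C * `|x - z|.
  rewrite lerBlDr (le_trans _ (lerD (hC _) (lexx _)))//.
  by rewrite -[X in nrm X <= _](subrK (z^T)) -linearB; exact: norm_triangle.
have -> : `|nrm w^T - nrm y^T| = Num.max (nrm w^T - nrm y^T) (nrm y^T - nrm w^T).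
  by rewrite -[nrm y^T - _]opprB maxC maxNr.
have -> : e = (C + 1) * (e / (C + 1)) by rewrite mulrCA divff ?mulr1// gt_eqF.
have wy : `|w - y| <= e / (C + 1).
  by near: y; apply: cvgr_dist_le => //; rewrite divr_gt0.
apply: (@le_trans _ _ (C * `|w - y|)).
  by rewrite ge_max le_sub distrC le_sub.
by rewrite ler_pM// ler_wpDr.
Unshelve. all: by end_near. Qed.

(** Equivalence of norms: the continuous positive function [nrm] attains a
    positive minimum on the compact unit sphere of the maximum norm. *)
Lemma nrm_ge_max : exists2 c : R, 0 < c & forall w : 'rV_n, c * `|w| <= nrm w^T.
Proof.
pose S := [set w : 'rV[R]_n | `|w| = 1].
have scale_sphere (w : 'rV[R]_n) : w != 0 -> S (`|w|^-1 *: w).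
  by move=> w0; rewrite /S /= normrZ normfV normr_id mulVf// normr_eq0.
have [S0|/set0P S0] := eqVneq S set0.
  exists 1 => // w; have [->|/scale_sphere] := eqVneq w 0.
    by rewrite normr0 mulr0 nrm_ge0.
  by rewrite S0.
have cS : compact S.
  apply: bounded_closed_compact.
    by exists 1; split=> // M M1 w /= ->; exact: ltW.
  rewrite (_ : S = Num.norm @^-1` [set x | x = 1]); last by [].
  by apply: closed_comp; [move=> w _; exact: norm_continuous | exact: closed_eq].
have [w0 w0S minw] := EVT_min_rV S0 cS (continuous_subspaceT nrm_tr_continuous).
have w0_neq0 : w0 != 0.
  apply/eqP => w0E; move: w0S; rewrite inE /S /= w0E normr0 => /eqP.
  by rewrite eq_sym oner_eq0.
have c0 : 0 < nrm w0^T.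
  apply: nrm_gt0; apply: contraNneq w0_neq0 => wT0.
  by rewrite -(trmxK w0) wT0 trmx0.
exists (nrm w0^T) => // w; have [->|wn0] := eqVneq w 0.
  by rewrite normr0 mulr0 nrm_ge0.
have /mem_set/minw := scale_sphere _ wn0.
rewrite linearZ (norm_homogeneous nrm_norm) normfV normr_id.
by rewrite -(ler_pM2r (_ : 0 < `|w|)) ?normr_gt0// mulrAC mulVf ?mul1r// normr_eq0.
Qed.

(** [sup] is only meaningful on sets bounded above, so the inequality
    [dual_norm_dot_le] rests on this. *)
Lemma dual_norm_has_ubound v : has_ubound [set dot v u | u in [set u | nrm u <= 1]].
Proof.
have [c c0 hc] := nrm_ge_max.
exists (\sum_i `|v i 0| / c) => _ [u /= u1 <-].
rewrite dotE (le_trans (ler_norm _))// (le_trans (ler_norm_sum _ _ _))//.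
apply: ler_sum => i _; rewrite normrM ler_wpM2l// -(mul1r c^-1) ler_pdivlMr//.
rewrite mulrC (le_trans _ u1)// -[u in nrm u]trmxK (le_trans _ (hc _))//.
by rewrite ler_wpM2l ?(ltW c0)// (_ : u i 0 = u^T 0 i) ?coord_le_norm// mxE.
Qed.

Lemma dual_norm_dot_le v u : dot v u <= dual_norm nrm v * nrm u.
Proof.
have [->|u0] := eqVneq u 0.
  by rewrite nrm0 mulr0 -(scale0r 0) dotZr mul0r.
rewrite -ler_pdivrMr ?nrm_gt0// mulrC -dotZr.
apply: ub_le_sup; first exact: dual_norm_has_ubound.
exists ((nrm u)^-1 *: u) => //=.
rewrite (norm_homogeneous nrm_norm) ger0_norm ?invr_ge0 ?nrm_ge0// mulVf//.
by rewrite gt_eqF ?nrm_gt0.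
Qed.

Lemma dual_norm_gt0 v : v != 0 -> 0 < dual_norm nrm v.
Proof.
move=> v0; have := lt_le_trans (dot_gt0 _ v0) (dual_norm_dot_le v v).
by rewrite pmulr_lgt0// nrm_gt0.
Qed.

Lemma dual_norm_approx v r : r < dual_norm nrm v ->
  exists2 u, nrm u <= 1 & r < dot v u.
Proof.
move=> /sup_gt[|_ [u u1 <-] ru]; last by exists u.
by exists (dot v 0), 0 => //=; rewrite nrm0 ler01.
Qed.

End dual_norm.

(** * Finitely supported measures *)

Section discrete.
Context {d} {T : measurableType d} {R : realType} {I : finType}.
Local Open Scope ereal_scope.
Import HBNNSimple.

(** No measurability is assumed: the integral of a nonnegative function is a
    supremum over the simple functions below it.  This avoids having to prove
    that the transport cost is measurable for the product sigma-algebra. *)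
Lemma ge0_le_integralT (mu : {measure set T -> \bar R}) (f g : T -> \bar R) :
  (forall x, 0 <= f x) -> (forall x, f x <= g x) ->
  \int[mu]_x f x <= \int[mu]_x g x.
Proof.
move=> f0 fg; have g0 x : 0 <= g x by exact: le_trans (f0 x) (fg x).
rewrite !ge0_integralTE//; apply: ereal_sup_le => _ [h hf <-].
by exists h => // x; exact: le_trans (hf x) (fg x).
Qed.

Variables (p : I -> R) (z : I -> T).
Hypothesis p_ge0 : forall i, (0 <= p i)%R.

Lemma finite_sum_dirac_measure (r : seq I) : exists mu : {measure set T -> \bar R},
  (forall A, mu A = \sum_(i <- r) (p i)%:E * \d_(z i) A) /\
  forall f : T -> \bar R, (forall x, 0 <= f x) -> measurable_fun [set: T] f ->
    \int[mu]_x f x = \sum_(i <- r) (p i)%:E * f (z i).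
Proof.
elim: r => [|i r [mu [muE intE]]].
  exists mzero; split=> [A|f f0 mf]; first by rewrite big_nil.
  by rewrite integral_measure_zero big_nil.
pose nu : {measure set T -> \bar R} :=
  mscale (NngNum (p_ge0 i)) (\d_(z i) : {measure set T -> \bar R}).
exists (measure_add nu mu); split=> [A|f f0 mf].
  by rewrite big_cons -muE; exact: measure_addE.
rewrite ge0_integral_measure_add// intE// big_cons; congr (_ + _).
by rewrite ge0_integral_mscale//= integral_dirac// diracT mul1e.
Qed.

(** Without measurability of [f] equality may fail, but each simple function
    below [f] is measurable, hence integrates to at most the weighted sum. *)
Lemma ge0_integral_discrete_le (mu : {measure set T -> \bar R}) (f : T -> \bar R) :
  (forall A, measurable A -> mu A = \sum_i (p i)%:E * \d_(z i) A) ->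
  (forall x, 0 <= f x) -> \int[mu]_x f x <= \sum_i (p i)%:E * f (z i).
Proof.
move=> muE f0.
have [nu [nuE nu_int]] := finite_sum_dirac_measure (index_enum I).
rewrite (eq_measure_integral nu); last by move=> A mA _; rewrite muE// nuE.
rewrite ge0_integralTE//; apply: ge_ereal_sup => _ [h /= hf <-].
rewrite -integralT_nnsfun nu_int//.
- by apply: lee_sum => i _; rewrite lee_wpmul2l ?lee_fin.
- by move=> x; rewrite lee_fin.
- exact/measurable_EFinP.
Qed.

Lemma discrete_probability : (\sum_i p i = 1)%R ->
  exists P : probability T R, forall A, P A = \sum_i (p i)%:E * \d_(z i) A.
Proof.
move=> p1; have [mu [muE _]] := finite_sum_dirac_measure (index_enum I).
have mu1 : mu setT = 1.
  rewrite muE (eq_bigr (fun i => (p i)%:E)) => [|i _]; last by rewrite diracT mule1.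
  by rewrite sumEFin p1.
have /existsP[i0 _] : [exists i : I, true].
  apply: contraPT p1 => /existsPn I0; apply/eqP.
  by rewrite big1 1?eq_sym ?oner_eq0// => i _; have := I0 i.
(* [mnormalize] only bundles [mu], whose total mass is 1, as a probability;
   the Dirac measure is a default value. *)
have muP A : mnormalize mu (\d_(z i0)) A = mu A.
  by rewrite /mnormalize mu1 onee_eq0/= invr1 mule1.
by exists (mnormalize mu (\d_(z i0))) => A; rewrite -muE; exact: muP.
Qed.
End discrete.

Lemma big_pair_bool (V : nmodType) (I : finType) (F : I * bool -> V) :
  \sum_ib F ib = \sum_i (F (i, true) + F (i, false)).
Proof.
rewrite (eq_bigr (fun ib => F (ib.1, ib.2))) => [|[]//].
rewrite -(pair_bigA _ (fun i b => F (i, b))).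
by apply: eq_bigr => i _; rewrite big_bool.
Qed.

(** * The fractional knapsack problem *)

Section knapsack.
Context {R : realType} {N : nat}.
Variables (d : 'I_N -> R) (eps : R).
Hypotheses (N_gt0 : (0 < N)%N) (eps_gt0 : 0 < eps) (eps_lt1 : eps < 1).

Let N0 : 0 < N%:R :> R. Proof. by rewrite ltr0n. Qed.

(** The least [d k] whose lower level set holds at least a fraction [eps] of
    the items is an [eps]-quantile: the items strictly below it, if any, form
    the lower level set of a smaller [d j], by minimality too small to qualify. *)
Lemma quantile_exists : exists t : R,
  #|[set i | d i < t]%SET|%:R <= eps * N%:R <= #|[set i | d i <= t]%SET|%:R.
Proof.
have [k0 _ maxk0] : exists2 k0 : 'I_N, true & forall i, d i <= d k0.
  case: (@arg_maxP _ _ _ (Ordinal N_gt0) xpredT d) => // k _ hk.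
  by exists k => // i; exact: hk.
pose P k := eps * N%:R <= #|[set i | d i <= d k]%SET|%:R.
have Pk0 : P k0.
  rewrite /P.
  have -> : [set i | d i <= d k0]%SET = [set: 'I_N]%SET
    by apply/setP => i; rewrite !inE maxk0.
  by rewrite cardsT card_ord ler_piMl// ltW.
case: (@arg_minP _ _ _ k0 P d Pk0) => k Pk mink; exists (d k).
apply/andP; split; last exact: Pk.
have [->|/set0Pn[j0]] := eqVneq [set i | d i < d k]%SET finset.set0.
  by rewrite cards0 mulr_ge0// ltW.
rewrite inE => j0k.
case: (@arg_maxP _ _ _ j0 (fun j => d j < d k) d j0k) => j jk maxj.
have -> : [set i | d i < d k]%SET = [set i | d i <= d j]%SET.
  apply/setP => i; rewrite !inE; apply/idP/idP; first exact: maxj.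
  by move=> /le_lt_trans; apply.
by apply: ltW; rewrite ltNge; apply: contraL jk => /mink; rewrite leNgt.
Qed.

(** Complementary slackness.  With [t] an [eps]-quantile, the greedy packing
    takes all items cheaper than [t] in full and the same share [al] of every
    item of cost [t]; then no duality gap remains. *)
Lemma knapsack_primal_dual : exists (t : R) (w : 'I_N -> R),
  [/\ forall i, 0 <= w i <= N%:R^-1, \sum_i w i = eps &
      \sum_i w i * d i = eps * t - N%:R^-1 * \sum_i Num.max (t - d i) 0].
Proof.
have [t /andP[lt_t ge_t]] := quantile_exists.
pose n1 : R := #|[set i | d i < t]%SET|%:R.
pose n2 : R := #|[set i | d i == t]%SET|%:R.
have n12 : #|[set i | d i <= t]%SET|%:R = n1 + n2.
  rewrite /n1 /n2 -natrD -cardsUI (_ : _ :&: _ = finset.set0)%SET.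
    rewrite cards0 addn0; congr (#|pred_of_set _|%:R).
    by apply/setP => i; rewrite !inE le_eqVlt orbC.
  by apply/setP => i; rewrite !inE; case: ltgtP.
have n2_ge0 : 0 <= n2 by [].
pose al := (eps * N%:R - n1) / n2.
have al0 : 0 <= al by rewrite divr_ge0// subr_ge0.
have al1 : al <= 1.
  have [n20|n20] := eqVneq n2 0; first by rewrite /al n20 invr0 mulr0.
  by rewrite ler_pdivrMr ?lt_neqAle 1?eq_sym ?n20// mul1r lerBlDl -n12.
have aln2 : al * n2 = eps * N%:R - n1.
  have [n20|n20] := eqVneq n2 0; last by rewrite divfK.
  by rewrite n20 mulr0; move: lt_t ge_t; rewrite n12 n20 -/n1; lra.
pose c i : R := (d i < t)%R%:R + al * (d i == t)%R%:R.
have c01 i : 0 <= c i <= 1.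
  by rewrite /c; case: ltgtP => _ /=;
    rewrite ?mulr0 ?mulr1 ?addr0 ?add0r ?lexx ?ler01 ?al0 ?al1.
have sumc : \sum_i c i = eps * N%:R.
  rewrite /c big_split/= -mulr_sumr.
  have card (Q : pred 'I_N) : \sum_i (Q i)%:R = #|[set i | Q i]%SET|%:R :> R.
    by rewrite -natr_sum -big_mkcond sum1dep_card.
  by rewrite !card -/n1 -/n2 aln2 addrC subrK.
exists t, (fun i => c i / N%:R); split.
- move=> i; have /andP[c0 c1] := c01 i.
  by rewrite divr_ge0//= -[leRHS]mul1r ler_wpM2r.
- by rewrite -mulr_suml sumc mulfK// gt_eqF.
- have -> : eps * t = N%:R^-1 * \sum_i c i * t.
    by rewrite -mulr_suml sumc; field; rewrite gt_eqF.
  rewrite -mulrBr -sumrB mulr_sumr; apply: eq_bigr => i _.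
  rewrite mulrAC mulrC; congr (_ * _); rewrite /c.
  case: (ltgtP (d i) t) => [dt|dt|->] /=.
  + by rewrite max_l ?subr_ge0 ?ltW// mulr0 addr0 !mul1r opprB addrC subrK.
  + by rewrite max_r ?subr_le0 ?ltW// mulr0 addr0 !mul0r subr0.
  + by rewrite subrr maxxx subr0.
Qed.

(** Here [eps < 1] makes the total strictly larger than [eps]: a small mixture
    with the full packing raises the total, and the strict budget absorbs the
    additional cost. *)
Lemma knapsack_duality (beta : R) :
  (forall t, eps * t - N%:R^-1 * \sum_i Num.max (t - d i) 0 < beta) ->
  exists w : 'I_N -> R,
  [/\ forall i, 0 <= w i <= N%:R^-1, eps < \sum_i w i & \sum_i w i * d i < beta].
Proof.
move=> dual_lt; have [t [w [w01 sumw costw]]] := knapsack_primal_dual.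
have {dual_lt} cost_lt : \sum_i w i * d i < beta by rewrite costw.
pose m := \sum_i N%:R^-1 * d i.
pose c := \sum_i w i * d i.
(* [m] is the cost of the full packing; the mixture has cost
   [c + eta * (m - c)], below the budget for small [eta]. *)
have [eta [eta0 eta1 hcost]] : exists eta,
    [/\ 0 < eta, eta <= 1 & c + eta * (m - c) < beta].
  have [mc|mc] := leP m c; first exists 1.
    by rewrite ltr01 lexx mul1r; split=> //; rewrite addrC subrK (le_lt_trans mc).
  pose e := Num.min 1 ((beta - c) / (2 * (m - c))).
  have e0 : 0 < e by rewrite lt_min ltr01 divr_gt0 ?mulr_gt0 ?subr_gt0.
  exists e; split=> //; first by rewrite ge_min lexx.
  have : e * (m - c) <= (beta - c) / 2.
    rewrite -ler_pdivlMr ?subr_gt0// -mulrA -invfM ge_min.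
    by rewrite [X in _ || X]lexx orbT.
  by move: cost_lt; rewrite -/c; lra.
exists (fun i => (1 - eta) * w i + eta * N%:R^-1); split.
- move=> i; have /andP[w0 w1] := w01 i.
  rewrite addr_ge0 ?mulr_ge0 ?subr_ge0 ?invr_ge0 ?(ltW eta0) ?(ltW N0)//=.
  have : (1 - eta) * w i <= (1 - eta) * N%:R^-1 by rewrite ler_wpM2l ?subr_ge0.
  lra.
- have sumV : \sum_(i < N) eta * N%:R^-1 = eta.
    by rewrite sumr_const card_ord -[LHS]mulr_natr mulfVK// gt_eqF.
  rewrite big_split/= -mulr_sumr sumw sumV.
  have : 0 < eta * (1 - eps) by rewrite mulr_gt0 ?subr_gt0.
  lra.
- rewrite [ltLHS](_ : _ = c + eta * (m - c))//.
  rewrite (eq_bigr (fun i => (1 - eta) * (w i * d i) + eta * (N%:R^-1 * d i))).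
    by rewrite big_split/= /m -!mulr_sumr -/c; ring.
  by move=> i _; ring.
Qed.

End knapsack.

(** * Worst-case mass of a half-space over a Wasserstein ball *)

Section borel.
Context {R : realType} {K : nat}.
Local Notation T := (borel_cV R K).

Lemma continuous_borel_measurable (f : 'cV[R]_K -> R) :
  continuous f -> measurable_fun [set: T] (f : T -> R).
Proof.
move=> /continuousP cf.
apply: (measurability _ (RGenOpens.measurableE R)) => _ [_ [a [b ->]] <-].
by rewrite setTI; apply: sub_gen_smallest; apply: cf; exact: interval_open.
Qed.

Lemma affine_borel_measurable (v : 'cV[R]_K) (r : R) :
  measurable_fun [set: T] ((fun y => dot v y + r) : T -> R).
Proof.
apply: measurable_funD => //.
by apply: continuous_borel_measurable; exact: dot_continuous.
Qed.

Lemma halfspace_measurable (v : 'cV[R]_K) (r : R) :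
  measurable ([set y | dot v y + r <= 0] : set T).
Proof.
have := affine_borel_measurable v r measurableT _ (measurable_itv `]-oo, 0]%R).
by rewrite setTI; congr (measurable _); apply/seteqP; split=> y /=; rewrite in_itv.
Qed.
End borel.

Section ambiguity.
Context {R : realType} {K N : nat} {nrm : 'cV[R]_K -> R}.
Hypothesis nrm_norm : is_norm nrm.
Variables (N_gt0 : (0 < N)%N) (xi : 'I_N -> 'cV[R]_K).
Variables (v : 'cV[R]_K) (r : R).
Hypothesis v_neq0 : v != 0.
Local Notation T := (borel_cV R K).

Let lam := dual_norm nrm v.
Let lam_gt0 : 0 < lam. Proof. exact: dual_norm_gt0. Qed.
Let d (y : 'cV[R]_K) : R := Num.max (dot v y + r) 0.
Let U : set T := [set y | dot v y + r <= 0].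
Let mU : measurable U. Proof. exact: halfspace_measurable. Qed.

Let N0 : 0 < N%:R :> R. Proof. by rewrite ltr0n. Qed.
Let d_ge0 y : 0 <= d y. Proof. by rewrite /d le_max lexx orbT. Qed.

(** For unsafe [y], Hoelder's inequality bounds [d z] by [lam * nrm (y - z)]:
    the margin must drop from [d z] to [0] on the way from [z] to [y]. *)
Lemma unsafe_indic_le (t : R) (y z : 'cV[R]_K) : 0 <= t ->
  t * \1_U y <= lam * nrm (y - z) + Num.max (t - d z) 0.
Proof.
move=> t0; rewrite indicE.
have cost0 : 0 <= lam * nrm (y - z) by rewrite mulr_ge0 ?(nrm_ge0 nrm_norm)// ltW.
have [yU|yU] := boolP (y \in U); last first.
  by rewrite mulr0 addr_ge0// le_max lexx orbT.
have dz : d z <= lam * nrm (y - z).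
  rewrite /d ge_max cost0 andbT -[y - z]opprB (nrmN nrm_norm).
  apply: le_trans (dual_norm_dot_le nrm_norm v (z - y)).
  by move: yU; rewrite inE /U /= dotBr; lra.
by rewrite mulr1 -lerBlDl le_max lerB.
Qed.

(** The pointwise bound [unsafe_indic_le], integrated over every coupling. *)
Lemma unsafe_mass_le_wasserstein (t : R) (P : probability T R) : 0 <= t ->
  (((t * fine (P U) - N%:R^-1 * \sum_i Num.max (t - d (xi i)) 0) / lam)%:E
    <= wasserstein nrm P (empirical xi N_gt0))%E.
Proof.
move=> t0; apply: le_ereal_inf_tmp => _ [Q cQ <-].
pose k (y : T) : R := Num.max (t - d y) 0.
(* [h] is a measurable minorant of the transport cost that still carries the
   pointwise bound, so that linearity of the integral applies to it. *)
pose h (z : T * T) : R := Num.max ((t * \1_U z.1 - k z.2) / lam) 0.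
have k0 y : 0 <= k y by rewrite /k le_max lexx orbT.
have h0 z : 0 <= h z by rewrite /h le_max lexx orbT.
have hE z : t * \1_U z.1 <= lam * h z + k z.2.
  rewrite -lerBlDr [lam * _]mulrC -ler_pdivrMr// /h.
  by rewrite le_max lexx.
have h_le z : h z <= nrm ((z.1 : 'cV_K) - z.2).
  rewrite /h ge_max (nrm_ge0 nrm_norm) andbT ler_pdivrMr// lerBlDr [_ * lam]mulrC.
  exact: unsafe_indic_le.
have mk : measurable_fun [set: T] k.
  apply: measurable_maxr => //; apply: measurable_funB => //.
  by apply: measurable_maxr => //; exact: affine_borel_measurable.
have mk2 : measurable_fun [set: T * T] (k \o snd) by exact: measurableT_comp.
have mI : measurable_fun [set: T * T] (fun z => \1_U z.1 : R).
  exact: (measurableT_comp (measurable_indic mU)).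
have mh : measurable_fun [set: T * T] h.
  apply: measurable_maxr => //; apply: measurable_funM => //.
  by apply: measurable_funB => //; exact: measurable_funM.
apply: (@le_trans _ _ (\int[Q]_z (h z)%:E)%E); last first.
  by apply: ge0_le_integralT => z; rewrite lee_fin.
have intU : (\int[Q]_z (t * \1_U z.1)%:E = (t * fine (P U))%:E)%E.
  under eq_integral do rewrite EFinM.
  rewrite ge0_integralZl_EFin//; last exact/measurable_EFinP.
  rewrite EFinM fineK ?fin_num_measure//; congr (_ * _)%E.
  rewrite (_ : (fun z : T * T => _) = (fun z => (\1_(fst @^-1` U) z)%:E)) //.
  rewrite integral_indic ?setIT//; first exact: (cQ U mU).1.
  by rewrite -[X in measurable X]setTI; exact: measurable_fst.
have intk : (\int[Q]_z (k z.2)%:E <= (N%:R^-1 * \sum_i k (xi i))%:E)%E.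
  rewrite (_ : (\int[Q]_z _)%E = (\int[pushforward Q snd]_y (k y)%:E)%E).
    rewrite (_ : (_ * _)%:E = (\sum_i (N%:R^-1)%:E * (k (xi i))%:E)%E); last first.
      by rewrite mulr_sumr -sumEFin.
    apply: ge0_integral_discrete_le => //.
    move=> A mA; rewrite -ge0_sume_distrr => [|i _]; last by [].
    exact: (cQ A mA).2.
  rewrite ge0_integral_pushforward//.
  - exact/measurable_EFinP.
  - by move=> y _; rewrite lee_fin.
have lam0 := ltW lam_gt0.
have split_le : ((t * fine (P U))%:E <= lam%:E * \int[Q]_z (h z)%:E
    + (N%:R^-1 * \sum_i k (xi i))%:E)%E.
  rewrite -intU (le_trans _ (leeD2l _ intk))//.
  rewrite -ge0_integralZl_EFin//; last 2 first.
  - by move=> z _; rewrite lee_fin.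
  - exact/measurable_EFinP.
  rewrite -ge0_integralD//.
  - apply: ge0_le_integralT => z; first by rewrite lee_fin mulr_ge0.
    by rewrite -EFinM -EFinD lee_fin.
  - by move=> z _; rewrite mule_ge0 ?lee_fin.
  - exact/measurable_funeM/measurable_EFinP.
  - by move=> z _; rewrite lee_fin.
  - exact/measurable_EFinP.
move: split_le; have : (0 <= \int[Q]_z (h z)%:E)%E.
  by apply: integral_ge0 => z _; rewrite lee_fin.
case: (\int[Q]_z (h z)%:E)%E => [c _|_ _|//]; last by rewrite leey.
rewrite -EFinM -EFinD !lee_fin => tc; rewrite ler_pdivrMr//.
by rewrite lerBlDr [c * lam]mulrC.
Qed.

(** The witness splits the mass [1 / N] of each sample: [w i] is carried along
    [- u] just far enough to annihilate the margin, the rest stays in place. *)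
Lemma transport_to_unsafe (theta : R) (w : 'I_N -> R) : 0 < theta ->
  (forall i, 0 <= w i <= N%:R^-1) -> \sum_i w i * d (xi i) < theta * lam ->
  exists2 P : probability T R, ambiguity_set nrm N_gt0 xi theta P &
    ((\sum_i w i)%:E <= P U)%E.
Proof.
move=> theta0 w01 cost_lt.
have w0 i : 0 <= w i by have /andP[] := w01 i.
have w1 i : 0 <= N%:R^-1 - w i by rewrite subr_ge0; have /andP[] := w01 i.
pose c := \sum_i w i * d (xi i).
have c0 : 0 <= c by apply: sumr_ge0 => i _; rewrite mulr_ge0.
(* The cost is strictly below [theta * lam], so a vector [u] of norm
   at most 1 and close enough to optimal in the dual norm already makes
   [c / dot v u <= theta]. *)
have [u u1 cu] : exists2 u, nrm u <= 1 & c / theta < dot v u.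
  by apply: dual_norm_approx => //; rewrite ltr_pdivrMr// mulrC.
have vu0 : 0 < dot v u by apply: le_lt_trans cu; rewrite divr_ge0// ltW.
pose y i := xi i - (d (xi i) / dot v u) *: u.
have yU i : U (y i).
  rewrite /U /= /y dotBr dotZr divfK ?gt_eqF//.
  have : dot v (xi i) + r <= d (xi i) by rewrite le_max lexx.
  lra.
pose p (ib : 'I_N * bool) := if ib.2 then w ib.1 else N%:R^-1 - w ib.1.
pose z (ib : 'I_N * bool) : T * T := (if ib.2 then y ib.1 else xi ib.1, xi ib.1).
have p0 ib : 0 <= p ib by rewrite /p; case: ifP.
have p1 : \sum_ib p ib = 1.
  rewrite big_pair_bool (eq_bigr (fun=> N%:R^-1)) => [|i _].
    by rewrite sumr_const card_ord -[LHS]mulr_natr mulVf// gt_eqF.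
  by rewrite /p/= addrC subrK.
have [Q QE] := discrete_probability p z p0 p1.
have [P PE] := discrete_probability p (fst \o z) p0 p1.
exists P.
- apply: (@le_trans _ _ (\int[Q]_z (nrm ((z.1 : 'cV[R]_K) - z.2))%:E)%E).
    apply: ereal_inf_lbound; exists Q => // A mA; split.
      rewrite PE; exact: QE.
    transitivity (\sum_i (N%:R^-1 : R)%:E * (\d_(xi i : T) A : \bar R))%E; last first.
      by rewrite -ge0_sume_distrr.
    rewrite [LHS]QE big_pair_bool; apply: eq_bigr => i _; rewrite /p /z /=.
    by rewrite -ge0_muleDl ?lee_fin// -EFinD addrC subrK.
  apply: le_trans (ge0_integral_discrete_le _ _ p0 _ _ _ _) _.
  + by move=> A _; exact: QE.
  + by move=> ?; rewrite lee_fin; exact: nrm_ge0.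
  rewrite big_pair_bool.
  rewrite (eq_bigr (fun i => (w i * nrm (y i - xi i))%:E)) => [|i _]; last first.
    by rewrite /p /z /= subrr (nrm0 nrm_norm) mule0 adde0.
  rewrite sumEFin lee_fin (@le_trans _ _ (c / dot v u))//; last first.
    by rewrite ler_pdivrMr// mulrC -ler_pdivrMr// ltW.
  rewrite /c mulr_suml; apply: ler_sum => i _; rewrite -mulrA ler_wpM2l//.
  rewrite /y addrAC subrr add0r (nrmN nrm_norm) (norm_homogeneous nrm_norm).
  by rewrite ger0_norm ?divr_ge0 ?(ltW vu0)// ler_piMr// divr_ge0// ltW.
- rewrite PE big_pair_bool -sumEFin; apply: lee_sum => i _.
  rewrite /p /z /= diracE mem_set// mule1 leeDl// mule_ge0// lee_fin; exact: w1.
Qed.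

(** The condition on [t] is the negation of the premise of [knapsack_duality]
    with budget [theta * lam], scaled by [N].  Conversely it forces [t > 0], so
    that the bound on [t * P U] from [unsafe_mass_le_wasserstein] is a bound on
    [P U]. *)
Lemma robust_chance_iff (theta eps : R) : 0 < theta -> 0 < eps < 1 ->
  (forall P : probability T R, ambiguity_set nrm N_gt0 xi theta P ->
     ((1 - eps)%:E <= P (~` U))%E) <->
  exists t, theta * N%:R * lam <=
    eps * N%:R * t - \sum_i Num.max (t - d (xi i)) 0.
Proof.
move=> theta0 /andP[eps0 eps1]; split.
- move=> robust; apply/not_existsP => none.
  have [w [w01 eps_w cost_w]] : exists w : 'I_N -> R,
      [/\ forall i, 0 <= w i <= N%:R^-1,
      eps < \sum_i w i & \sum_i w i * d (xi i) < theta * lam].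
    apply: knapsack_duality => // t.
    have /negP := none t; rewrite -ltNge => none_t.
    rewrite -(ltr_pM2r N0) mulrBl.
    rewrite [X in _ - X < _]mulrAC mulVf ?gt_eqF// mul1r.
    by move: none_t; lra.
  have [P FP PU] := transport_to_unsafe theta w theta0 w01 cost_w.
  have := robust P FP; rewrite probability_setC// leNgt => /negP; apply.
  have PUfin : P U \is a fin_num by exact: fin_num_measure.
  move: PU; rewrite -(fineK PUfin) -EFinB lee_fin lte_fin.
  by move: eps_w; lra.
- move=> [t ht] P FP.
  have S0 : 0 <= \sum_i Num.max (t - d (xi i)) 0.
    by apply: sumr_ge0 => i _; rewrite le_max lexx orbT.
  have t0 : 0 < t.
    have : 0 < eps * N%:R * t.
      rewrite (lt_le_trans _ (_ : theta * N%:R * lam <= _))// ?mulr_gt0//.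
      by move: ht S0; lra.
    by rewrite pmulr_rgt0// mulr_gt0.
  have := unsafe_mass_le_wasserstein t P (ltW t0).
  move=> /le_trans/(_ FP); rewrite lee_fin ler_pdivrMr// => bound.
  have PUfin : P U \is a fin_num by exact: fin_num_measure.
  rewrite probability_setC// -(fineK PUfin) -EFinB lee_fin lerD2l lerN2.
  set p := fine (P U) in bound *; set m := \sum_i _ in ht bound.
  have {}bound : t * p * N%:R <= theta * lam * N%:R + m.
    have := ler_wpM2l (ltW N0) bound.
    by rewrite mulrBr mulVKf ?gt_eqF// -/lam; lra.
  rewrite -(ler_pM2l t0) -(ler_pM2r N0).
  by move: ht; lra.
Qed.
End ambiguity.

(** * Linearization with binary variables *)

(** For given [t] the least admissible [s i] is [(t - (f i)^+)^+], and then
    [t - s i <= (f i)^+ <= M], so that [q i] may be taken to be the indicator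
    of [f i <= 0]. *)
Lemma big_M_iff {R : realType} {N : nat} (f : 'I_N -> R) (g c M : R) :
  (forall i, `|f i| <= M) ->
  (exists t, c <= g * t - \sum_i Num.max (t - Num.max (f i) 0) 0) <->
  exists (q s : 'cV[R]_N) (t : R),
    [/\ c <= g * t - dot (const_mx 1) s,
        forall i, t - s i 0 <= f i + M * q i 0,
        forall i, t - s i 0 <= M * (1 - q i 0),
        forall i, q i 0 = 0 \/ q i 0 = 1 & forall i, 0 <= s i 0].
Proof.
move=> fM.
have dot1 (s : 'cV[R]_N) : dot (const_mx 1) s = \sum_i s i 0.
  by rewrite dotE; apply: eq_bigr => i _; rewrite mxE mul1r.
split=> [[t ht]|[q [s [t [hc h0 h1 hq hs]]]]]; last first.
  exists t; apply: le_trans hc _; rewrite lerB// dot1; apply: ler_sum => i _.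
  rewrite ge_max hs andbT lerBlDr -lerBlDl le_max.
  have := h0 i; have := h1 i.
  by case: (hq i) => ->; rewrite ?mulr0 ?addr0 ?subrr ?mulr0 => t1 t0;
    rewrite ?t0 ?t1 ?orbT.
exists (\col_i (f i <= 0)%R%:R), (\col_i Num.max (t - Num.max (f i) 0) 0), t.
have min_le i : t - Num.max (t - Num.max (f i) 0) 0 <= Num.max (f i) 0.
  by rewrite lerBlDr -lerBlDl le_max lexx.
split.
- by rewrite dot1; under eq_bigr do rewrite mxE.
- move=> i; rewrite !mxE (le_trans (min_le i))//.
  have := fM i; rewrite ler_norml => /andP[fM1 fM2].
  case: (leP (f i) 0) => fi /=; rewrite ?mulr1 ?mulr0 ?addr0//.
  by rewrite -lerBlDl sub0r lerNl.
- move=> i; rewrite !mxE (le_trans (min_le i))//.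
  have := fM i; rewrite ler_norml => /andP[fM1 fM2].
  by case: (leP (f i) 0) => fi /=; rewrite ?subrr ?mulr0 ?subr0 ?mulr1.
- by move=> i; rewrite mxE; case: (f i <= 0); [right|left].
- by move=> i; rewrite mxE le_max lexx orbT.
Qed.

Lemma compact_uniform_bound {R : realType} {n N : nat} (X : set 'cV[R]_n)
    (f : 'I_N -> 'cV[R]_n -> R) :
  compact X -> (forall i, continuous (f i)) ->
  exists2 M0 : R, 0 < M0 & forall x i, X x -> `|f i x| <= M0.
Proof.
move=> cX cf.
have bnd i : exists M : R, forall x, X x -> `|f i x| <= M.
  have : compact (f i @` X).
    by apply: continuous_compact => //; exact: continuous_subspaceT.
  move=> /compact_bounded[M [_ hM]]; exists (M + 1) => x Xx.
  by apply: hM; rewrite ?ltrDl//; exists x.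
have [M hM] := choice bnd.
exists (1 + \sum_i `|M i|); first by rewrite ltr_wpDr// sumr_ge0.
move=> x i /hM/le_trans; apply; rewrite (le_trans (ler_norm _))//.
by rewrite (bigD1 i)//= addrCA lerDl addr_ge0// sumr_ge0.
Qed.

(** * Comparison of the two programs *)

(** The right-hand side exhibits the margin as an affine function of [x]. *)
Lemma margin_eq {R : realType} {K L : nat} (A : 'M[R]_(L, K)) a b b0 x y :
  dot (b - A^T *m x) y + b0 - dot a x = dot b y + b0 - dot (A *m y + a) x.
Proof.
by rewrite dotBl -dot_mulmx [dot (_ + _) x]dotC dotDr ![dot x _]dotC; lra.
Qed.

Lemma safety_setE {R : realType} {K L : nat} (A : 'M[R]_(L, K)) a b b0 x :
  safety_set A a b b0 x = ~` [set y | dot (b - A^T *m x) y + (b0 - dot a x) <= 0].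
Proof.
apply/seteqP; split=> y; rewrite /safety_set /= addrA margin_eq subr_le0 ltNge.
  by move/negP.
by move=> ?; apply/negP.
Qed.

Section projected_program.
Context {R : realType} {D E : Type} (F : set D) (G : set (E * D)) (f : D -> R).
Hypothesis proj : forall x, F x <-> exists e, G (e, x).

Lemma optimal_value_proj : optimal_value F f = optimal_value G (fun z => f z.2).
Proof.
congr (ereal_inf _); apply/seteqP; split=> [_ [x /proj[e Gex] <-]|_ [[e x] Gex <-]].
  by exists (e, x).
by exists x => //; apply/proj; exists e.
Qed.

Lemma minimizers_proj x :
  minimizers F f x <-> exists e, minimizers G (fun z => f z.2) (e, x).
Proof.
split=> [[/proj[e Gex] minx]|[e [Gex minx]]].
  by exists e; split=> // -[e' y] Gey; apply: minx; apply/proj; exists e'.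
by split=> [|y /proj[e' Gey]]; [apply/proj; exists e | exact: (minx (e', y))].
Qed.
End projected_program.

Theorem proposition1 (R : realType) (K L N : nat)
    (nrm : 'cV[R]_K -> R) (N_gt0 : (0 < N)%N) (xi : 'I_N -> 'cV[R]_K)
    (X : set 'cV[R]_L) (c : 'cV[R]_L) (theta eps : R)
    (A : 'M[R]_(L, K)) (a : 'cV[R]_L) (b : 'cV[R]_K) (b0 : R) :
  is_norm nrm ->
  polyhedron X -> compact X ->
  0 < theta -> 0 < eps < 1 ->
  (forall x, X x -> A^T *m x <> b) ->
  exists2 M0 : R, 0 < M0 & forall M : R, M0 <= M ->
    let CC := cc_feasible A a b b0 nrm xi theta eps X N_gt0 in
    let MICP := micp_feasible A a b b0 nrm xi theta eps X M in
    let cost := fun x => dot c x in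
    let micp_cost := fun z : 'cV[R]_N * 'cV[R]_N * R * 'cV[R]_L =>
      dot c z.2 in
    [/\ forall x, CC x <-> exists q s t, MICP (q, s, t, x),
        optimal_value CC cost = optimal_value MICP micp_cost &
        forall x, minimizers CC cost x <->
          exists q s t, minimizers MICP micp_cost (q, s, t, x)].
Proof.
move=> nrm_norm _ cX theta0 eps01 Xb.
pose f (i : 'I_N) x := dot (b - A^T *m x) (xi i) + b0 - dot a x.
have cf i : continuous (f i).
  have -> : f i = fun x => dot b (xi i) + b0 - dot (A *m xi i + a) x.
    by apply/funext => x; exact: margin_eq.
  by move=> x; apply: (@cvgB _ _ _ _ (nbhs_filter x));
    [exact: cvg_cst | exact: dot_continuous].
have [M0 M0_gt0 fM0] := compact_uniform_bound X f cX cf.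
exists M0 => // M M0M CC MICP cost micp_cost.
have feasible x : CC x <-> exists q s t, MICP (q, s, t, x).
  have [Xx|nXx] := pselect (X x); last first.
    by split=> [[]//|[q [s [t [_ _ _ []]]]]].
  have v_neq0 : b - A^T *m x != 0.
    by rewrite subr_eq0 eq_sym; apply/eqP; exact: Xb.
  have fM i : `|f i x| <= M by exact: le_trans (fM0 x i Xx) M0M.
  have robust := robust_chance_iff nrm_norm N_gt0 xi _ (b0 - dot a x) v_neq0
    theta eps theta0 eps01.
  have bigM := big_M_iff (fun i => f i x) (eps * N%:R)
    (theta * N%:R * dual_norm nrm (b - A^T *m x)) M fM.
  have {}robust : (forall P, ambiguity_set nrm N_gt0 xi theta P ->
      ((1 - eps)%:E <= P (safety_set A a b b0 x))%E) <->
      exists t, theta * N%:R * dual_norm nrm (b - A^T *m x) <=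
        eps * N%:R * t - \sum_i Num.max (t - Num.max (f i x) 0) 0.
    rewrite safety_setE; apply: (iff_trans robust).
    have sumE t : \sum_i Num.max (t - Num.max (dot (b - A^T *m x) (xi i) +
        (b0 - dot a x)) 0) 0 = \sum_i Num.max (t - Num.max (f i x) 0) 0.
      by apply: eq_bigr => i _; rewrite addrA.
    by split=> -[t ht]; exists t; [rewrite -sumE | rewrite sumE].
  split=> [[_ /robust/bigM[q [s [t [h1 h2 h3 h4 h5]]]]]|].
    by exists q, s, t.
  move=> [q [s [t [h1 h2 h3 [h4 h5 _]]]]]; split=> //.
  by apply/robust/bigM; exists q, s, t.
have feasible_proj x : CC x <-> exists e, MICP (e, x).
  split=> [/feasible[q [s [t]]]|[[[q s] t] h]]; first by exists (q, s, t).
  by apply/feasible; exists q, s, t.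
split=> //; first exact: (optimal_value_proj _ _ _ feasible_proj).
move=> x; split=> [/(minimizers_proj _ _ _ feasible_proj)[[[q s] t]]|[q [s [t h]]]].
  by exists q, s, t.
by apply/(minimizers_proj _ _ _ feasible_proj); exists (q, s, t).
Qed.
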